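(* Let $q$ be a prime power. If there exists a strongly regular $q$-ary graph with parameters $(v,k,\lambda,\mu;q)$, then there exists a strongly regular graph with parameters $([v]_q,[k+1]_q-1,\lambda,\mu)$.
   Context: For an integer $a\ge 0$, $[a]_q=\sum_{i=0}^{a-1}q^i=\frac{q^a-1}{q-1}$, which is the number of $1$-dimensional subspaces of $\mathbb{F}_q^a$. A strongly regular graph with parameters $(n,d,\lambda,\mu)$ is a simple undirected $d$-regular graph on $n$ vertices such that any two distinct adjacent vertices have exactly $\lambda$ common neighbors and any two distinct non-adjacent vertices have exactly $\mu$ common neighbors (complete and empty graphs are allowed; a condition about pairs that do not occur is vacuous). A $q$-ary graph with underlying vector space $W$ over $\mathbb{F}_q$ is a pair $\mathcal{E}=(V,E)$ where $V$ is the set of all $1$-dimensional subspaces of $W$ (the vertices) and $E$ is a set of $2$-dimensional subspaces of $W$ (the edges). Two vertices $X,Y$ are adjacent if the span $\langle X,Y\rangle$ is an element of $E$ (in particular $X\neq Y$). The neighborhood $N_{\mathcal{E}}(X)$ of a vertex $X$ is the set consisting of $X$ and all vertices adjacent to $X$. A set of $1$-dimensional subspaces is identified with a subspace $U$ when it is exactly the set of all $1$-dimensional subspaces of $U$. Let $v\ge 1$ and $k\ge 0$ be integers. A $q$-ary graph $\mathcal{E}$ with underlying vector space $\mathbb{F}_q^v$ is $k$-regular if for every vertex $X$ the neighborhood $N_{\mathcal{E}}(X)$ is a $(k+1)$-dimensional subspace of $\mathbb{F}_q^v$. A $k$-regular $q$-ary graph $\mathcal{E}$ with underlying vector space $\mathbb{F}_q^v$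 is a strongly regular $q$-ary graph with parameters $(v,k,\lambda,\mu;q)$ ($\lambda,\mu$ integers) if for all vertices $X\ne Y$ the number of vertices in $(N_{\mathcal{E}}(X)\cap N_{\mathcal{E}}(Y))\setminus\{X,Y\}$ equals $\lambda$ if $X$ and $Y$ are adjacent, and equals $\mu$ otherwise. If no adjacent (resp. no non-adjacent) pairs of distinct vertices exist, the condition on $\lambda$ (resp. $\mu$) is vacuous and that parameter is arbitrary. *)

(* Defs.v *)
From HB Require Import structures.
From mathcomp Require Import all_boot all_order all_algebra.

Set Implicit Arguments.
Unset Strict Implicit.
Unset Printing Implicit Defensive.

Import GRing.Theory VectorInternalTheory.
Local Open Scope ring_scope.

(* The subspaces of a vector space over a finite field form a finite type, so
   that sets of subspaces can be counted; the library stops at choiceType. The subtype structure of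
   {vspace W} used here is only available in VectorInternalTheory. *)
HB.instance Definition _ (F : finFieldType) (W : vectType F) :=
  [Countable of {vspace W} by <:].
HB.instance Definition _ (F : finFieldType) (W : vectType F) :=
  [Finite of {vspace W} by <:].

Definition prime_power (q : nat) : Prop :=
  exists p m : nat, [/\ prime p, (0 < m)%N & q = (p ^ m)%N].

(* [a]_q *)
Definition qnum (q a : nat) : nat := (\sum_(i < a) q ^ i)%N.

(* The parameters lambda, mu of both kinds of strongly regular graphs are
   integers: each is unconstrained when no pair of the relevant kind exists. *)
Definition srg (T : finType) (e : rel T) (n d : nat) (lambda mu : int) : Prop :=
  [/\ symmetric e /\ irreflexive e,
      #|T| = n,
      forall x : T, #|[set y | e x y]| = d
    & forall x y : T, x != y ->
        #|[set z | e x z && e y z]|%:Z = if e x y then lambda else mu].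

Section QGraph.
Variables (F : finFieldType) (W : vectType F).

Definition qpoints (U : {vspace W}) : {set {vspace W}} :=
  [set X | (\dim X == 1%N) && (X <= U)%VS].

Definition qvertices : {set {vspace W}} := [set X | \dim X == 1%N].

Record qgraph := QGraph {
  qedges : {set {vspace W}};
  qedges_dim : forall L, L \in qedges -> \dim L = 2
}.

Variable G : qgraph.

Definition qadj (X Y : {vspace W}) : bool := (X + Y)%VS \in qedges G.

Definition qnbhd (X : {vspace W}) : {set {vspace W}} :=
  X |: [set Y in qvertices | qadj X Y].

Definition qregular (k : nat) : Prop :=
  forall X, X \in qvertices ->
    exists U : {vspace W}, \dim U = k.+1 /\ qnbhd X = qpoints U.

(* The remaining parameters v and q of a strongly regular q-ary graph are the
   dimension of W and the order of F. *)
Definition qsrg (k : nat) (lambda mu : int) : Prop :=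
  qregular k /\
  forall X Y, X \in qvertices -> Y \in qvertices -> X != Y ->
    #|(qnbhd X :&: qnbhd Y) :\: [set X; Y]|%:Z =
      if qadj X Y then lambda else mu.

End QGraph.

(* Main.v *)
Require Import Defs.
From HB Require Import structures.
From mathcomp Require Import all_boot all_order all_algebra.
From mathcomp Require Import finfield.

Set Implicit Arguments.
Unset Strict Implicit.
Unset Printing Implicit Defensive.

Import GRing.Theory.
Local Open Scope ring_scope.

(** The strongly regular graph is the [q]-ary graph itself, read as an ordinary
    graph: the vertices are the points (one-dimensional subspaces) and two
    points are joined when their span is an edge.  The common neighbors of two
    distinct points are counted in the same way on both sides, so lambda and mu
    carry over unchanged.  The order and the degree are the number of points of
    the whole space and the number of points, other than the center, of a
    closed neighborhood; the latter is a subspace of dimension [k + 1] by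
    regularity.  Both numbers come from [card_qpoints], which counts the points
    of a subspace by partitioning its nonzero vectors into the lines that they
    span. *)

Section Points.
Variables (F : finFieldType) (W : vectType F).
Implicit Types (U X : {vspace W}) (u : W).

Lemma vline_eq_point X u :
  \dim X = 1%N -> u != 0 -> (<[u]>%VS == X) = (u \in X).
Proof.
move=> dimX u0; apply/idP/idP => [/eqP <-|uX]; first exact: memv_line.
by rewrite eqEdim dimX dim_vline u0 -memvE uX.
Qed.

(** An abstract vector space over a finite field has finitely many vectors, but
    its carrier is a finite type only through [finvect_type]. *)
Lemma card_mem_vspace U :
  #|[set u : finvect_type W | (u : W) \in U]| = (#|F| ^ \dim U)%N.
Proof.
rewrite cardsE.
(* [W] is split into carrier and structure because [card_vspace] concerns a
   structure in packed form, to which a variable [W] is not convertible. *)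
case: W U => T cT U.
exact: (@card_vspace F (finvect_type (Vector.Pack cT)) cT U).
Qed.

(** Double counting, with [q] the order of [F]: each of the [q ^ \dim U - 1]
    nonzero vectors of [U] spans exactly one point of [U], and each point is
    spanned by its [q - 1] nonzero vectors. *)
Lemma card_qpoints U : #|qpoints U| = qnum #|F| (\dim U).
Proof.
pose nonzero (V : {vspace W}) :=
  [set u : finvect_type W | ((u : W) != 0) && ((u : W) \in V)].
have card_nonzero V : #|nonzero V| = (#|F| ^ \dim V).-1.
  rewrite -card_mem_vspace [in RHS](cardD1 0) inE mem0v /=.
  by apply: eq_card => u; rewrite !inE.
have lineU (u : finvect_type W) : u \in nonzero U -> <[u : W]>%VS \in qpoints U.
  by rewrite !inE dim_vline -memvE => /andP[-> ->].
have q1_gt0 : (0 < #|F|.-1)%N by rewrite -subn1 subn_gt0 finNzRing_gt1.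
apply/eqP; rewrite -(eqn_pmul2l q1_gt0) -predn_exp -card_nonzero.
rewrite -[#|nonzero U|]sum1_card.
rewrite (partition_big (fun u : finvect_type W => <[u : W]>%VS)
                       (mem (qpoints U))) //=.
rewrite mulnC -sum_nat_const; apply/eqP/esym.
apply: eq_bigr => X; rewrite inE => /andP[/eqP dimX XU].
rewrite sum1dep_card -[#|F|](expn1) -dimX -card_nonzero; apply: eq_card => u.
rewrite !inE; have [//|u0] := eqVneq u 0; rewrite vline_eq_point //=.
by apply/andP/idP => [[]//|uX]; rewrite (subvP XU).
Qed.

Lemma qvertices_qpoints : qvertices W = qpoints fullv.
Proof. by apply/setP => X; rewrite !inE subvf andbT. Qed.

End Points.

Section PointGraph.
Variables (F : finFieldType) (W : vectType F) (G : qgraph W).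

Definition qpoint := {X : {vspace W} | X \in qvertices W}.

Definition point_adj : rel qpoint := fun x y => qadj G (val x) (val y).

Lemma qadj_sym : symmetric (qadj G).
Proof. by move=> X Y; rewrite /qadj addvC. Qed.

Lemma qadjxx X : X \in qvertices W -> qadj G X X = false.
Proof.
rewrite inE => /eqP dimX; apply/negP => /qedges_dim.
by rewrite addvv dimX.
Qed.

(** Transfers the counts from the type of vertices of the ordinary graph to the
    sets of subspaces in which neighborhoods live. *)
Lemma card_qpoint_set (P : pred {vspace W}) :
  #|[set x : qpoint | P (val x)]| = #|[set X in qvertices W | P X]|.
Proof.
rewrite -(card_imset _ val_inj); apply: eq_card => X; rewrite inE.
apply/imsetP/andP => [[x xP ->]|[XV PX]].
  by rewrite inE in xP; rewrite (valP x).
by exists (exist _ X XV); rewrite ?inE.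
Qed.

Lemma point_graph_srg k lambda mu :
  qsrg G k lambda mu ->
  srg point_adj (qnum #|F| (\dim {:W})) (qnum #|F| k.+1 - 1) lambda mu.
Proof.
case=> reg cn; split.
- split=> [x y|x]; first exact: qadj_sym.
  exact: qadjxx (valP x).
- rewrite card_sig -card_qpoints -qvertices_qpoints.
  by apply: eq_card => X; rewrite !inE.
- move=> x; have [U [dimU nbU]] := reg _ (valP x).
  rewrite -dimU -card_qpoints -nbU card_qpoint_set /qnbhd cardsU1.
  by rewrite inE (qadjxx (valP x)) andbF addKn.
- move=> x y xy; rewrite -(cn _ _ (valP x) (valP y) xy).
  rewrite (card_qpoint_set (fun Z => qadj G (val x) Z && qadj G (val y) Z)).
  congr Posz; apply: eq_card => Z; rewrite !inE.
  (* A point is not adjacent to itself, so removing the pair only cancels the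
     centers of the two closed neighborhoods. *)
  have [->|_] := eqVneq Z (val x); first by rewrite (qadjxx (valP x)) !andbF.
  have [->|_] := eqVneq Z (val y); first by rewrite (qadjxx (valP y)) !andbF.
  by case: (\dim Z == 1%N).
Qed.

End PointGraph.

Theorem theorem3p16 (q : nat) (q_pp : prime_power q)
    (F : finFieldType) (cardF : #|F| = q)
    (v k : nat) (v_gt0 : (0 < v)%N) (lambda mu : int) :
  (exists G : qgraph 'rV[F]_v, qsrg G k lambda mu) ->
  exists (T : finType) (e : rel T),
    srg e (qnum q v) (qnum q k.+1 - 1)%N lambda mu.
Proof.
case=> G /point_graph_srg; rewrite cardF dimvf /dim /= mul1n => srgG.
by exists (qpoint _), (point_adj G).
Qed.
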